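(* Let $Q=(Q_0,Q_1)$ be a finite quiver, let $n\ge 0$ be an integer, and let $\beta=(n,n,\ldots,n)\in\mathbb{Z}_{\ge 0}^{Q_0}$. Impose the complete standard filtration of vector spaces at each vertex, let $F^{\bullet}Rep(Q,\beta)\cong\mathfrak{b}^{\oplus Q_1}$ be the corresponding filtered representation space, and let $\mathbb{U}=U^{\oplus Q_0}$ act on it by change of basis. Then $\dim_{\mathbb{C}}\mathrm{Spec}\big(\mathbb{C}[F^{\bullet}Rep(Q,\beta)]^{\mathbb{U}}\big)$ is finite.
   Context: A quiver $Q=(Q_0,Q_1)$ is a directed graph with vertex set $Q_0$ and arrow set $Q_1$; each arrow $a$ has a tail $ta\in Q_0$ and a head $ha\in Q_0$. It is finite if $Q_0$ and $Q_1$ are finite. $\mathfrak{b}$ denotes the space of upper triangular $n\times n$ complex matrices, and $U$ the group of upper triangular $n\times n$ complex matrices with all diagonal entries equal to $1$. The complete standard filtration of $\mathbb{C}^n$ is $0\subseteq\mathbb{C}^1\subseteq\cdots\subseteq\mathbb{C}^n$, where $\mathbb{C}^j$ is the span of the first $j$ standard basis vectors. $F^{\bullet}Rep(Q,\beta)$ is the subspace of $\bigoplus_{a\in Q_1}\mathrm{Hom}_{\mathbb{C}}(\mathbb{C}^n,\mathbb{C}^n)$ of all tuples $W=(W(a))_{a\in Q_1}$ such that each $W(a)$ maps $\mathbb{C}^j$ into $\mathbb{C}^j$ for all $j$; thus it is identified with $\mathfrak{b}^{\oplus Q_1}$. The group $\mathbb{U}=U^{\oplus Q_0}$ acts by $(u^{(i)})_{i\in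 Q_0}\cdot(W(a))_{a\in Q_1}=\big(u^{(ha)}W(a)(u^{(ta)})^{-1}\big)_{a\in Q_1}$, and $\mathbb{C}[F^{\bullet}Rep(Q,\beta)]^{\mathbb{U}}$ is the algebra of $\mathbb{U}$-invariant polynomial functions on $F^{\bullet}Rep(Q,\beta)$. *)

(* Defs.v *)
From HB Require Import structures.
From mathcomp Require Import all_boot all_order all_algebra.
From mathcomp Require Import boolp reals complex mpoly.

Set Implicit Arguments.
Unset Strict Implicit.
Unset Printing Implicit Defensive.

Import GRing.Theory.
Local Open Scope ring_scope.

(* Loops and multiple arrows are allowed, and either set may be empty. *)
Record finQuiver := FinQuiver {
  vertex : finType;
  arrow : finType;
  tail : arrow -> vertex;
  head : arrow -> vertex }.

(* Points of Spec A: mathcomp's [prime_idealr] are the proper prime ideals,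
   given by boolean predicates; with the choice axioms of [boolp] this is no
   restriction, every set being decidable. *)
Definition Spec (A : comNzRingType) := prime_idealr A.

Definition spec_lt (A : comNzRingType) (p q : Spec A) : Prop :=
  {subset p <= q} /\ ~ {subset q <= p}.

(* A strict chain p 0 < ... < p k has length k. *)
Definition prime_chain (A : comNzRingType) (k : nat) (p : nat -> Spec A) :=
  forall i, (i < k)%N -> spec_lt (p i) (p i.+1).

(* dim (Spec A) = d, the dimension being the supremum of the lengths of
   strict chains of primes. *)
Definition dim_Spec_is (A : comNzRingType) (d : nat) : Prop :=
  (exists p : nat -> Spec A, prime_chain d p) /\
  (forall (k : nat) (p : nat -> Spec A), prime_chain k p -> (k <= d)%N).

Definition dim_Spec_finite (A : comNzRingType) : Prop :=
  exists d : nat, dim_Spec_is A d.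

Section FilteredRep.

Variables (K : fieldType) (Q : finQuiver) (n : nat).

(* The span of the first j standard basis vectors. *)
Definition std_flag (j : nat) : {vspace 'cV[K]_n} :=
  <<[seq delta_mx i 0%R | i : 'I_n <- enum 'I_n & (i < j)%N]>>%VS.

Definition filtered_mx (A : 'M[K]_n) : Prop :=
  forall (j : nat) (v : 'cV[K]_n),
    (j <= n)%N -> v \in std_flag j -> A *m v \in std_flag j.

Definition upper_trig_mx (A : 'M[K]_n) : Prop :=
  forall i j : 'I_n, (j < i)%N -> A i j = 0.

Lemma std_flagP (j : nat) (v : 'cV[K]_n) :
  v \in std_flag j <-> (forall i : 'I_n, (j <= i)%N -> v i 0 = 0).
Proof.
split=> [|v0].
  rewrite /std_flag; set s := (X in span X) => sv i le_ji.
  rewrite (coord_span (X := in_tuple s) sv) summxE big1 // => k _; rewrite mxE.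
  have /mapP[l] : (in_tuple s)`_k \in s by rewrite mem_nth.
  rewrite mem_filter => /andP[lt_lj _] ->; rewrite mxE.
  case: eqP => [eq_il|_]; last by rewrite mulr0.
  by rewrite eq_il leqNgt lt_lj in le_ji.
rewrite (matrix_sum_delta v) rpred_sum // => i _; rewrite big_ord1.
have [le_ji|lt_ij] := leqP j i; first by rewrite v0 // scale0r rpred0.
apply/rpredZ/memv_span/mapP; exists i => //.
by rewrite mem_filter lt_ij mem_enum.
Qed.

Lemma filtered_mxP (A : 'M[K]_n) : filtered_mx A <-> upper_trig_mx A.
Proof.
split=> [fA i j lt_ji | tA j v _ /std_flagP v0].
  have /std_flagP/(_ i lt_ji) : A *m delta_mx j 0 \in std_flag j.+1.
    apply: fA => //; apply/std_flagP => k lt_jk; rewrite mxE andbT.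
    by case: eqP => // eq_kj; rewrite eq_kj ltnn in lt_jk.
  by rewrite -colE mxE.
apply/std_flagP => i le_ji; rewrite mxE big1 // => k _.
have [le_jk|lt_kj] := leqP j k; first by rewrite v0 // mulr0.
by rewrite tA ?mul0r // (leq_trans lt_kj).
Qed.

(* The elements of the group U. *)
Definition unipotent_mx (u : 'M[K]_n) : Prop :=
  upper_trig_mx u /\ (forall i : 'I_n, u i i = 1).

Definition rep := arrow Q -> 'M[K]_n.

Definition filtered_rep (W : rep) : Prop := forall a, filtered_mx (W a).

Definition base_change (u : vertex Q -> 'M[K]_n) (W : rep) : rep :=
  fun a => u (head a) *m W a *m invmx (u (tail a)).

(* Index set of the coordinates of b^{Q_1}: the entries (i, j), i <= j, of the
   matrix at each arrow. *)
Definition coord_idx : finType :=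
  {x : arrow Q * ('I_n * 'I_n) | (x.2.1 <= x.2.2)%N}.

(* The coordinate ring of F Rep(Q, beta).  It is written as a polynomial ring;
   when K is infinite, its elements are the same thing as polynomial functions
   on the space of filtered representations. *)
Definition coord_ring := {mpoly K[#|coord_idx|]}.

Definition rep_coord (W : rep) (k : 'I_#|coord_idx|) : K :=
  let x := val (enum_val k) in W x.1 x.2.1 x.2.2.

Definition eval_rep (f : coord_ring) (W : rep) : K := f.@[rep_coord W].

Definition U_invariant (f : coord_ring) : Prop :=
  forall (u : vertex Q -> 'M[K]_n) (W : rep),
    (forall i, unipotent_mx (u i)) -> filtered_rep W ->
    eval_rep f (base_change u W) = eval_rep f W.

Definition U_invariant_pred : {pred coord_ring} :=
  fun f => `[< U_invariant f >].

Lemma U_invariant_subring : subring_closed U_invariant_pred.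
Proof.
split=> [|f g /asboolP invf /asboolP invg|f g /asboolP invf /asboolP invg];
  apply/asboolP => u W uu fW; rewrite /eval_rep.
- by rewrite !rmorph1.
- by rewrite !rmorphB /=; congr (_ - _); [exact: invf | exact: invg].
- by rewrite !rmorphM /=; congr (_ * _); [exact: invf | exact: invg].
Qed.

HB.instance Definition _ :=
  GRing.isSubringClosed.Build coord_ring U_invariant_pred U_invariant_subring.

Record invariant_ring := InvariantRing {
  invariant_val :> coord_ring;
  _ : invariant_val \in U_invariant_pred }.

HB.instance Definition _ := [isSub for invariant_val].
HB.instance Definition _ := [Choice of invariant_ring by <:].
HB.instance Definition _ :=
  [SubChoice_isSubComNzRing of invariant_ring by <:].

End FilteredRep.

(* Main.v *)
(** Any N+1 elements of the polynomial ring in N variables over a field are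
    algebraically dependent, by counting dimensions.  Let p_0 < ... < p_(N+1)
    be a chain of primes in a subalgebra and x_i in p_(i+1) but not in p_i.  In
    a relation between the x_i over K, let x^e be the lexicographically least
    monomial, with coefficient 1.  The relation reads
      x_0^e_0 (x_1^e_1 (... (x_N^e_N (1 + b_N x_N) + ...) + b_1 x_1) + b_0 x_0)
        = 0,
    and descending through the brackets, working modulo p_0, p_1, ... in turn,
    gives 1 + b_N x_N in p_(N+1), hence 1 in p_(N+1), a contradiction.  Thus
    every K-subalgebra of the polynomial ring has dimension at most N, whether
    or not it is finitely generated. *)
Require Import Defs.
From mathcomp Require Import all_boot all_order all_algebra.
From mathcomp Require Import reals complex.
From HB Require Import structures.
From mathcomp Require Import boolp mpoly.

Set Implicit Arguments.
Unset Strict Implicit.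
Unset Printing Implicit Defensive.

Import GRing.Theory.
Local Open Scope ring_scope.

(* The general polynomial in [xs] with exponents [< m].  The exponents of a
   monomial are the base-[m] digits of the index of its coefficient, so that
   the order of the indices is the lexicographic order. *)
Fixpoint box_sum (A : comNzRingType) (m : nat) (xs : seq A) (c : nat -> A) : A :=
  if xs is x :: xs' then
    \sum_(j < m) x ^+ j *
      box_sum m xs' (fun k => c (j * m ^ size xs' + k)%N)
  else c 0%N.

(** * Box sums along chains of primes *)

Section BoxSum.

Variables (A : comNzRingType) (m : nat).

Lemma box_sum_ext (xs : seq A) (c c' : nat -> A) :
  c =1 c' -> box_sum m xs c = box_sum m xs c'.
Proof. by move=> /funext ->. Qed.

Lemma box_sum_linear (xs : seq A) (a : A) (c c' : nat -> A) :
  box_sum m xs (fun k => a * c k + c' k) =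
  a * box_sum m xs c + box_sum m xs c'.
Proof.
elim: xs c c' => [|x xs IH] c c' //=.
rewrite mulr_sumr -big_split; apply: eq_bigr => j _ /=.
by rewrite IH mulrDr mulrCA.
Qed.

Lemma rmorph_box_sum (B : comNzRingType) (f : {rmorphism A -> B})
    (xs : seq A) (c : nat -> A) :
  f (box_sum m xs c) = box_sum m (map f xs) (f \o c).
Proof.
elim: xs c => [|x xs IH] c //=; rewrite rmorph_sum.
by apply: eq_bigr => j _; rewrite rmorphM rmorphXn IH size_map.
Qed.

Lemma box_sum_eq0 (xs : seq A) (c : nat -> A) :
  (forall k, (k < m ^ size xs)%N -> c k = 0) -> box_sum m xs c = 0.
Proof.
elim: xs c => [|x xs IH] c c0 //=; first by rewrite c0.
rewrite big1 // => j _; rewrite IH ?mulr0 // => k lt_k; apply: c0.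
rewrite expnS (@leq_trans (j.+1 * m ^ size xs)) //.
  by rewrite mulSn addnC ltn_add2r.
by rewrite leq_mul2r ltn_ord orbT.
Qed.

(** Nonzero coefficients are units, hence lie in no prime; this settles the empty list. The
    induction drops the head of [xs] together with the first prime. *)
Lemma box_sum_prime_chain (xs : seq A) (c : nat -> A) (p : nat -> Spec A) :
  (forall k, c k = 0 \/ exists b, b * c k = 1) ->
  (exists2 k, (k < m ^ size xs)%N & c k != 0) ->
  (forall i, {subset p i <= p i.+1}) ->
  (forall i, (i < size xs)%N -> xs`_i \in p i.+1 /\ xs`_i \notin p i) ->
  box_sum m xs c \notin p 0%N.
Proof.
elim: xs c p => [|x xs IH] c p cU.
  case=> k; rewrite expn0 ltnS leqn0 => /eqP -> /eqP c0 _ _ /=.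
  have [//|[b bc1]] := cU 0%N; apply/negP => cp.
  by have := idealr1 (p 0%N); rewrite -bc1 prime_idealrM cp orbT.
case=> k0 lt_k0 ck0 sub_p xsp /=.
have [xp1 xp0] := xsp 0%N isT.
(* [nz j]: some coefficient in the block multiplying [x ^+ j] is nonzero. The least such [j0] is the
   power of [x] to factor out. *)
pose nz := fun j => [exists r : 'I_(m ^ size xs), c (j * m ^ size xs + r)%N != 0].
have ms_gt0 : (0 < m ^ size xs)%N.
  by move: lt_k0 => /=; rewrite expnS; case: (m ^ size xs)%N => //; rewrite muln0.
have nz0 : nz (k0 %/ m ^ size xs)%N.
  apply/existsP; exists (Ordinal (ltn_pmod k0 ms_gt0)).
  by rewrite /= -divn_eq.
have exj : exists j, nz j by exists (k0 %/ m ^ size xs)%N.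
case: (ex_minnP exj) => j0 /existsP[r cr] min_j0.
have lt_j0 : (j0 < m)%N.
  by apply: leq_ltn_trans (min_j0 _ nz0) _; rewrite ltn_divLR // -expnS.
set S := fun j => box_sum m xs (fun k => c (j * m ^ size xs + k)%N).
have Slt0 j : (j < j0)%N -> S j = 0.
  move=> lt_j; apply: box_sum_eq0 => k lt_k; apply/eqP/negPn/negP => cjk.
  have /min_j0 : nz j by apply/existsP; exists (Ordinal lt_k).
  by rewrite leqNgt lt_j.
have Sj0 : S j0 \notin p 1%N.
  apply: (IH _ (fun i => p i.+1)) => [k|||i lt_i]; first exact: cU.
  - by exists r.
  - by move=> i; apply: sub_p.
  - exact: (xsp i.+1 lt_i).
pose T := \sum_(j < m | (j0 < j)%N) x ^+ (j - j0.+1) * S j.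
have -> : \sum_(j < m) x ^+ j * S j = x ^+ j0 * (S j0 + x * T).
  rewrite (bigD1 (Ordinal lt_j0)) //= mulrDr; congr (_ + _).
  rewrite /T !mulr_sumr [LHS]big_mkcond [RHS]big_mkcond; apply: eq_bigr => j _.
  rewrite -val_eqE /=; case: ltngtP => //= [lt_j|lt_j].
    by rewrite !mulrA -exprSr -exprD subnKC.
  by rewrite Slt0 // mulr0.
have xj0 : x ^+ j0 \notin p 0%N.
  elim: j0 {min_j0 cr lt_j0 Slt0 Sj0 T} => [|j IHj].
    by rewrite expr0 idealr1.
  by rewrite exprS prime_idealrM negb_or IHj andbT.
(* If [S j0 + x * T] were in [p 0], it would be in [p 1], as [x * T] is, forcing [S j0] into
   [p 1]. *)
rewrite prime_idealrM negb_or xj0; apply/negP => /sub_p Sp.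
have xT : x * T \in p 1%N by rewrite prime_idealrM xp1.
by move: Sj0; rewrite -[S j0](addrK (x * T)) rpredB.
Qed.

End BoxSum.

(** * Algebraic dependence by counting dimensions *)

Section AlgebraicDependence.

Variables (K : fieldType) (N : nat).
Local Notation MP := {mpoly K[N]}.

Lemma msizeM_leS (p q : MP) (d e : nat) :
  (msize p <= d.+1)%N -> (msize q <= e.+1)%N -> (msize (p * q) <= (d + e).+1)%N.
Proof.
have [->|p0] := eqVneq p 0; first by rewrite mul0r msize0.
have [->|q0] := eqVneq q 0; first by rewrite mulr0 msize0.
move=> pd qe; rewrite msizeM // -subn1 leq_subLR add1n -addSn -addnS.
exact: leq_add.
Qed.

Lemma msizeX_leS (p : MP) (d j : nat) :
  (msize p <= d.+1)%N -> (msize (p ^+ j) <= (j * d).+1)%N.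
Proof.
move=> pd; elim: j => [|j IHj]; first by rewrite expr0 msize1.
by rewrite exprS mulSn; apply: msizeM_leS.
Qed.

Lemma msize_box_sum (m D : nat) (xs : seq MP) (c : nat -> K) :
  (forall x, x \in xs -> (msize x <= D.+1)%N) ->
  (msize (box_sum m xs (fun k => (c k)%:MP)) <= (size xs * (m * D)).+1)%N.
Proof.
elim: xs c => [|x xs IH] c xsD /=; first by rewrite msizeC; case: (_ != 0).
apply: (leq_trans (msize_sum _ _ _)); apply/bigmax_leqP => j _.
rewrite mulSn; apply: msizeM_leS.
  apply: (leq_trans (msizeX_leS j (xsD x (mem_head _ _)))).
  by rewrite ltnS leq_mul2r ltnW ?orbT.
by apply: IH => y y_xs; apply: xsD; rewrite inE y_xs orbT.
Qed.

(** Total degree below [B] forces each exponent below [B]; the cube of such exponents has the simple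
    cardinality [B ^ N]. *)
Lemma mpoly_eq0_box (B : nat) (p : MP) : (msize p <= B)%N ->
  (forall e : {ffun 'I_N -> 'I_B}, p@_[multinom (e i : nat) | i < N] = 0) ->
  p = 0.
Proof.
move=> pB p0; apply/mpolyP => u; rewrite mcoeff0.
have [lt_uB|le_Bu] := ltnP (mdeg u) B; last first.
  by apply: memN_msupp_eq0; apply: msize_mdeg_ge; apply: leq_trans le_Bu.
have uiB i : (u i < B)%N.
  by apply: leq_ltn_trans lt_uB; rewrite mdegE (bigD1 i) //= leq_addr.
rewrite -(p0 [ffun i => Ordinal (uiB i)]); congr mcoeff.
by apply/mnmP => i; rewrite mnmE ffunE.
Qed.

Lemma linear_kernel (a b : nat) (f : {linear 'rV[K]_a -> 'rV[K]_b}) :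
  (b < a)%N -> exists2 v, v != 0 & f v = 0.
Proof.
move=> lt_ba; pose M := lin1_mx f.
have : kermx M != 0.
  rewrite -mxrank_eq0 mxrank_ker subn_eq0 -ltnNge.
  exact: leq_ltn_trans (rank_leq_col _) lt_ba.
move=> /rowV0Pn[v /sub_kermxP vM v0]; exists v => //.
by rewrite -mul_rV_lin1.
Qed.

Lemma box_sum_dependent (xs : seq MP) : (N < size xs)%N ->
  exists m (c : nat -> K), (exists2 k, (k < m ^ size xs)%N & c k != 0) /\
    box_sum m xs (fun k => (c k)%:MP) = 0.
Proof.
move=> lt_N; set s := size xs.
pose D := (\max_(x <- xs) msize x)%N.
(* There are [m ^ s] unknown coefficients and [B ^ N] equations. As [B <= C * m] and [C ^ N < m], [B
   ^ N <= C ^ N * m ^ N < m ^ N.+1 <= m ^ s]. *)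
pose C := (s * D).+1; pose m := (C ^ N).+1; pose B := (s * (m * D)).+1.
have lt_dim : (#|{ffun 'I_N -> 'I_B}| < m ^ s)%N.
  rewrite card_ffun !card_ord; apply: (@leq_ltn_trans ((C * m) ^ N)).
    suff: (B <= C * m)%N by case: (N) => // N' BCm; rewrite leq_exp2r.
    by rewrite /B /C mulSn mulnCA [(m * _)%N]mulnC addnC -addn1 leq_add2l.
  rewrite expnMn; apply: (@leq_trans (m ^ N.+1)).
    by rewrite expnS ltn_pmul2r ?expn_gt0.
  by rewrite leq_pexp2l.
pose coef (v : 'rV[K]_(m ^ s)) k := if insub k is Some i then v 0 i else 0.
pose P v := box_sum m xs (fun k => (coef v k)%:MP).
pose F v : 'rV[K]_#|{ffun 'I_N -> 'I_B}| :=
  \row_i (P v)@_[multinom ((enum_val i : {ffun 'I_N -> 'I_B}) j : nat) | j < N].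
have linF : linear F.
  move=> a v w; apply/rowP => i; rewrite !mxE.
  have -> : P (a *: v + w) = a%:MP * P v + P w.
    rewrite -box_sum_linear; apply: box_sum_ext => k.
    rewrite -mpolyCM -mpolyCD /coef; case: insub => [l|]; first by rewrite !mxE.
    by rewrite mulr0 addr0.
  by rewrite mul_mpolyC mcoeffD mcoeffZ.
pose lF : {linear 'rV[K]_(m ^ s) -> 'rV[K]_#|{ffun 'I_N -> 'I_B}|} :=
  HB.pack F (GRing.isLinear.Build _ _ _ _ F linF).
have [v v0 Fv] := linear_kernel lF lt_dim.
exists m, (coef v); split.
  have /rV0Pn[k vk] := v0; exists k => //=.
  by rewrite /coef valK.
apply: (@mpoly_eq0_box B).
  apply: msize_box_sum => x x_xs; rewrite leqW //.
  exact: (leq_bigmax_seq (F := fun x : MP => msize x)).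
move=> e; have /rowP/(_ (enum_rank e)) := Fv.
by rewrite !mxE enum_rankK.
Qed.

End AlgebraicDependence.

(** * Dimension of subalgebras *)

Lemma subalgebra_dim_le (K : fieldType) (N : nat) (A : comNzRingType)
    (f : {rmorphism A -> {mpoly K[N]}}) (const : K -> A) :
  injective f -> (forall a, f (const a) = a%:MP) ->
  forall (k : nat) (p : nat -> Spec A), prime_chain k p -> (k <= N)%N.
Proof.
move=> f_inj fconst k p ch; rewrite leqNgt; apply/negP => lt_Nk.
(* The bound on [i] stands under the existential so that [choice] yields a total sequence. *)
have step i : exists x, (i < k)%N -> x \in p i.+1 /\ x \notin p i.
  have [lt_ik|] := ltnP i k; last by exists 0.
  have [_ nsub] := ch i lt_ik; apply: contrapT => nx; apply: nsub => x xp.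
  by apply: contrapT => /negP nxp; apply: nx; exists x.
have [x xP] := choice step.
pose xs := mkseq x k.
have sz_xs : size xs = k by rewrite size_mkseq.
have lt_N : (N < size (map f xs))%N by rewrite size_map sz_xs.
have [m [c [[l lt_l cl] sum0]]] := box_sum_dependent lt_N.
(* Beyond [k] the chain is arbitrary, so it is made constant from there on. *)
pose q i := p (minn i k).
have : box_sum m xs (const \o c) \notin q 0%N.
  apply: (@box_sum_prime_chain _ _ _ _ q) => [j|||i]; rewrite /q.
  - rewrite /=; have [->|cj] := eqVneq (c j) 0.
      by left; apply: f_inj; rewrite fconst !rmorph0.
    right; exists (const (c j)^-1); apply: f_inj.
    by rewrite rmorphM !fconst rmorph1 -mpolyCM mulVf.
  - exists l; first by rewrite size_map in lt_l.
    apply: contraNneq cl => /(congr1 f); rewrite fconst rmorph0 => /eqP.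
    by rewrite mpolyC_eq0.
  - move=> i; have [lt_ik|le_ki] := ltnP i k.
      by rewrite (minn_idPl lt_ik); have [] := ch i lt_ik.
    by rewrite (minn_idPr _) // ltnW.
  - rewrite sz_xs => lt_ik; rewrite nth_mkseq //.
    by rewrite (minn_idPl lt_ik) (minn_idPl (ltnW lt_ik)); apply: xP.
(* Injectivity of [f] pulls the polynomial relation back to [A]. *)
suff -> : box_sum m xs (const \o c) = 0 by rewrite idealr0.
apply: f_inj; rewrite rmorph0 rmorph_box_sum -[RHS]sum0.
by apply: box_sum_ext => j /=; rewrite fconst.
Qed.

(** The prime [p0] is a chain of length 0, so the bounded set of lengths is nonempty and has a
    maximum. *)
Lemma dim_Spec_finite_bounded (A : comNzRingType) (p0 : Spec A) (N : nat) :
  (forall (k : nat) (p : nat -> Spec A), prime_chain k p -> (k <= N)%N) ->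
  dim_Spec_finite A.
Proof.
move=> bound; pose P k := `[< exists p : nat -> Spec A, prime_chain k p >].
have exP : exists k, P k by exists 0%N; apply/asboolP; exists (fun=> p0).
have leP k : P k -> (k <= N)%N by move=> /asboolP[p /bound].
have [d /asboolP Pd maxd] := ex_maxnP exP leP.
by exists d; split=> // k p ch; apply: maxd; apply/asboolP; exists p.
Qed.

Lemma zero_ideal_closed (A : comNzRingType) : idealr_closed (pred1 (0 : A)).
Proof.
split=> [||a x y]; rewrite !inE ?oner_eq0 //.
by move=> /eqP -> /eqP ->; rewrite mulr0 addr0.
Qed.

Lemma zero_ideal_prime (A : comNzRingType) :
  GRing.integral_domain_axiom A -> prime_idealr_closed (pred1 (0 : A)).
Proof. by move=> domA x y; rewrite !inE => /eqP /domA. Qed.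

Definition zero_prime (A : comNzRingType)
    (domA : GRing.integral_domain_axiom A) : Spec A :=
  HB.pack (pred1 (0 : A) : A -> bool)
    (isIdealr.Build A (pred1 (0 : A)) (zero_ideal_closed A))
    (isPrimeIdealrClosed.Build A (pred1 (0 : A)) (zero_ideal_prime domA)).

Section Invariants.

Variables (K : fieldType) (Q : finQuiver) (n : nat).
Local Notation A := (invariant_ring K Q n).

Lemma mpolyC_invariant (a : K) :
  (a%:MP : coord_ring K Q n) \in @U_invariant_pred K Q n.
Proof. by apply/asboolP => u W _ _; rewrite /eval_rep !mevalC. Qed.

(** The invariants contain the constants and embed in a polynomial ring in [#|coord_idx Q n|]
    variables; being a domain, they have the zero ideal as a prime. *)
Lemma invariant_ring_dim_finite : dim_Spec_finite A.
Proof.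
have domA (x y : A) : x * y = 0 -> (x == 0) || (y == 0).
  move=> /(congr1 val); rewrite rmorphM rmorph0 => /eqP.
  by rewrite mulf_eq0 -!(inj_eq val_inj) rmorph0.
apply: (@dim_Spec_finite_bounded _ (zero_prime domA) #|coord_idx Q n|).
pose const a : A := InvariantRing (mpolyC_invariant a).
exact: (@subalgebra_dim_le K _ A val const val_inj).
Qed.

End Invariants.

Theorem theorem1p2 (R : realType) (Q : finQuiver) (n : nat) :
  dim_Spec_finite (invariant_ring R[i] Q n).
Proof. exact: invariant_ring_dim_finite. Qed.
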